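(* Let $\nabla$ be a symplectic connection on a symplectic manifold $(M,\Omega)$. If there is a symplectic vector field $Z$ such that $\nabla_ZZ=0$, then for any $p\in M$ for which $Z_p\neq 0$, the symplectic sectional curvature of any two-dimensional symplectic subspace $L\subset T_pM$ containing $Z_p$ is not definite.
   Context: An affine connection $\nabla$ on $(M,\Omega)$ is symplectic if it is torsion-free and $\nabla\Omega=0$. Its curvature is $R(X,Y)Z=\nabla_X\nabla_YZ-\nabla_Y\nabla_XZ-\nabla_{[X,Y]}Z$. A two-dimensional subspace $L\subset T_pM$ is symplectic if $\Omega|_L$ is nondegenerate; for such $L$, $\mathscr{K}_{p,L}(Z)=\Omega(R(X,Y)Z,Z)/\Omega(X,Y)$ for any basis $X,Y$ of $L$ (independent of the choice), and the symplectic sectional curvature of $L$ is the restriction to $L$ of the quadratic form $\mathscr{K}_{p,L}$. ''Not definite'' means neither positive definite nor negative definite. A vector field $Z$ is symplectic if the Lie derivative of $\Omega$ along $Z$ vanishes. *)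

(* Defs.v *)
From HB Require Import structures.
From mathcomp Require Import all_boot all_order all_algebra.
From mathcomp Require Import all_classical all_reals all_analysis.

Set Implicit Arguments.
Unset Strict Implicit.
Unset Printing Implicit Defensive.

Import Order.TTheory GRing.Theory Num.Theory numFieldNormedType.Exports.

Local Open Scope classical_set_scope.
Local Open Scope ring_scope.

Section smooth_on.
Context {R : realType} {n : nat} {W : normedModType R}.
Implicit Types (U : set 'rV[R]_n) (f g : 'rV[R]_n -> W) (k : nat).

(* [f] is (k+1)-times Frechet differentiable on the open set [U]; the values
   of [f] outside [U] are irrelevant. *)
Fixpoint diff_on U k f : Prop :=
  (forall x, U x -> differentiable f x) /\
  if k is k'.+1 then forall v, diff_on U k' ('D_v f) else True.

Definition smooth_on U f : Prop := forall k, diff_on U k f.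

Lemma diff_on_differentiable U k f x :
  diff_on U k f -> U x -> differentiable f x.
Proof. by case: k => [|k] [+ _]; apply. Qed.

Lemma near0_differentiable f x :
  (\near x, f x = 0) -> differentiable f x.
Proof.
move=> f0.
have fx0 : f x = 0 by exact: nbhs_singleton f0.
have f0E : f \o shift x = cst (f x) + (\0 : 'rV[R]_n -> W) +o_ 0 id.
  apply/eqaddoP => _/posnumP[e].
  move: f0; rewrite (near_shift (0 : 'rV[R]_n)) subr0; apply: filterS => h /= fh.
  by rewrite !fctE /= fh fx0 addr0 subr0 normr0 mulr_ge0.
have d0 : 'd f x = \0 :> ('rV[R]_n -> W).
  by apply: diff_unique f0E; exact: cst_continuous.
apply/diff_locallyP; rewrite d0; split => //.
exact: cst_continuous.
Qed.

Lemma differentiable_eq_near f g x :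
  (\near x, f x = g x) -> differentiable f x -> differentiable g x.
Proof.
move=> fg df; have -> : g = f + (g - f) by rewrite addrC subrK.
apply: (differentiableD df); apply: near0_differentiable; near=> y.
rewrite !fctE; apply/eqP; rewrite subr_eq0 eq_sym; apply/eqP.
by near: y.
Unshelve. all: by end_near. Qed.

Lemma eq_diff_on U k f g : open U -> (forall x, U x -> f x = g x) ->
  diff_on U k f -> diff_on U k g.
Proof.
move=> oU; elim: k f g => [|k IH] f g fg [df dk]; split.
- move=> x Ux; apply: differentiable_eq_near (df _ Ux).
  by apply: filterS fg _; exact: open_nbhs_nbhs.
- by [].
- move=> x Ux; apply: differentiable_eq_near (df _ Ux).
  by apply: filterS fg _; exact: open_nbhs_nbhs.
- move=> v; apply: IH (dk v) => x Ux; apply: near_eq_derive.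
  by apply: filterS fg _; exact: open_nbhs_nbhs.
Qed.

Lemma diff_on_le U k f : diff_on U k.+1 f -> diff_on U k f.
Proof.
elim: k f => [|k IH] f [df dk]; split => // v.
by apply: IH; exact: dk.
Qed.

Lemma diff_onD U k f g : open U ->
  diff_on U k f -> diff_on U k g -> diff_on U k (f + g).
Proof.
move=> oU; elim: k f g => [|k IH] f g [df dkf] [dg dkg].
  by split=> [x Ux|//]; apply: differentiableD; [exact: df|exact: dg].
split=> [x Ux|v]; first by apply: differentiableD; [exact: df|exact: dg].
apply: (eq_diff_on oU) (IH _ _ (dkf v) (dkg v)) => x Ux.
by rewrite deriveD//; apply: diff_derivable; [exact: df|exact: dg].
Qed.

Lemma diff_on_cst U k (c : W) : open U -> diff_on U k (cst c).
Proof.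
move=> oU; elim: k c => [|k IH] c; split => // v.
apply: (eq_diff_on oU) (IH 0) => x _.
by rewrite derive_cst.
Qed.

End smooth_on.

Lemma diff_onM {R : realType} {n : nat} (U : set 'rV[R]_n) k
    (f g : 'rV[R]_n -> R) : open U ->
  diff_on U k f -> diff_on U k g -> diff_on U k (f * g).
Proof.
move=> oU; elim: k f g => [|k IH] f g; first last.
  move=> dSf dSg.
  have [df dkf] := dSf; have [dg dkg] := dSg; split.
    by move=> x Ux; apply: differentiableM; [exact: df|exact: dg].
  move=> v; pose h := f * 'D_v g + g * 'D_v f.
  have : diff_on U k h.
    apply: diff_onD => //; apply: IH.
    - exact: diff_on_le.
    - exact: dkg.
    - exact: diff_on_le.
    - exact: dkf.
  apply: (eq_diff_on oU) => x Ux.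
  by rewrite deriveM//; apply: diff_derivable; [exact: df|exact: dg].
by move=> [df _] [dg _]; split => // x Ux; apply: differentiableM;
  [exact: df|exact: dg].
Qed.

Section manifold.
Variables (R : realType) (n : nat).

(* [coord] (resp. [param]) is meaningful on [dom] (resp. [coord @` dom])
   only, where it is a homeomorphism onto its image with inverse [param]. *)
Record chart (M : topologicalType) := Chart {
  dom : set M;
  coord : M -> 'rV[R]_n;
  param : 'rV[R]_n -> M;
  dom_open : open dom;
  codom_open : open (coord @` dom);
  coordK : forall p, dom p -> param (coord p) = p;
  coord_continuous : forall p, dom p -> {for p, continuous coord};
  param_continuous : forall x, (coord @` dom) x -> {for x, continuous param}
}.

Record smoothManifold := SmoothManifold {
  carrier :> topologicalType;
  carrier_hausdorff : hausdorff_space carrier;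
  carrier_second_countable : @second_countable carrier;
  atlas : set (chart carrier);
  atlas_cover : forall p : carrier, exists2 c, atlas c & dom c p;
  atlas_compatible : forall c d, atlas c -> atlas d ->
    smooth_on (coord c @` (dom c `&` dom d)) (coord d \o param c)
}.

End manifold.

Section smooth_functions.
Context {R : realType} {n : nat}.
Variable M : smoothManifold R n.

Definition smooth (f : M -> R) : Prop :=
  forall c, atlas c -> smooth_on (coord c @` dom c) (f \o param c).

Definition smooth_pred : {pred M -> R} := [pred f | `[< smooth f >]].

Lemma smooth_subring_closed : subring_closed smooth_pred.
Proof.
have smoothM f g : smooth f -> smooth g -> smooth (f * g).
  move=> sf sg c Ac k; apply: diff_onM; [exact: codom_open|exact: sf|exact: sg].
have smooth_cst (a : R) : smooth (cst a).
  by move=> c Ac k; apply: diff_on_cst; exact: codom_open.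
split=> [|f g /asboolP sf /asboolP sg|f g /asboolP sf /asboolP sg].
- by apply/asboolP; exact: smooth_cst.
- apply/asboolP.
  have -> : f - g = f + cst (-1) * g.
    by apply/funext => x; rewrite !fctE mulN1r.
  move=> c Ac k; apply: (@diff_onD _ _ _ _ _ (f \o param c)).
  + exact: codom_open.
  + exact: sf.
  + exact: smoothM.
- by apply/asboolP; exact: smoothM.
Qed.

HB.instance Definition _ :=
  GRing.isSubringClosed.Build (M -> R) smooth_pred smooth_subring_closed.

Record smoothFun := SmoothFun {
  smooth_val :> M -> R;
  smooth_valP : smooth_val \in smooth_pred
}.

HB.instance Definition _ := [isSub for smooth_val].
HB.instance Definition _ := [Choice of smoothFun by <:].
HB.instance Definition _ := GRing.SubChoice_isSubComPzRing.Build
  (M -> R) smooth_pred smoothFun smooth_subring_closed.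

Lemma smooth_submod_closed : submod_closed smooth_pred.
Proof.
split=> [|a f g sf sg]; first exact: rpred0.
have sa : (cst a : M -> R) \in smooth_pred.
  by apply/asboolP => c Ac k; apply: diff_on_cst; exact: codom_open.
have -> : a *: f + g = cst a * f + g by [].
by rewrite rpredD// rpredM.
Qed.

HB.instance Definition _ :=
  GRing.isSubmodClosed.Build R (M -> R) smooth_pred smooth_submod_closed.
HB.instance Definition _ := [SubZmodule_isSubLmodule of smoothFun by <:].

End smooth_functions.

Section tangent_space.
Context {R : realType} {n : nat} {M : smoothManifold R n}.
Variable p : M.

Definition is_point_derivation (v : smoothFun M -> R) : Prop :=
  scalar v /\ forall f g, v (f * g) = f p * v g + g p * v f.

Definition point_derivation : {pred smoothFun M -> R} :=
  [pred v | `[< is_point_derivation v >]].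

Lemma point_derivation_submod_closed : submod_closed point_derivation.
Proof.
split=> [|a v w /asboolP[vl vM] /asboolP[wl wM]]; apply/asboolP; split.
- by move=> b f g; rewrite -[LHS]/0 -[RHS]/(b * 0 + 0) mulr0 addr0.
- by move=> f g; rewrite -[LHS]/0 -[RHS]/(f p * 0 + g p * 0) !mulr0 addr0.
- move=> b f g; rewrite -[LHS]/(a * v (b *: f + g) + w (b *: f + g)).
  rewrite -[RHS]/(b * (a * v f + w f) + (a * v g + w g)) vl wl.
  by rewrite !mulrDr (mulrCA b) addrACA.
- move=> f g; rewrite -[LHS]/(a * v (f * g) + w (f * g)).
  rewrite -[RHS]/(f p * (a * v g + w g) + g p * (a * v f + w f)) vM wM.
  by rewrite !mulrDr !(mulrCA a) addrACA.
Qed.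

HB.instance Definition _ := GRing.isSubmodClosed.Build
  R (smoothFun M -> R) point_derivation point_derivation_submod_closed.

Record tangent := Tangent {
  tangent_val :> smoothFun M -> R;
  tangent_valP : tangent_val \in point_derivation
}.

HB.instance Definition _ := [isSub for tangent_val].
HB.instance Definition _ := [Choice of tangent by <:].
HB.instance Definition _ := [SubChoice_isSubLmodule of tangent by <:].

End tangent_space.

Section vector_fields.
Context {R : realType} {n : nat}.
Variable M : smoothManifold R n.

Definition is_derivation (X : smoothFun M -> smoothFun M) : Prop :=
  linear X /\ forall f g, X (f * g) = f * X g + g * X f.

Definition derivation : {pred smoothFun M -> smoothFun M} :=
  [pred X | `[< is_derivation X >]].

Lemma derivation_zmod_closed : zmod_closed derivation.
Proof.
split=> [|X Y /asboolP[Xl XM] /asboolP[Yl YM]]; apply/asboolP; split.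
- by move=> b f g; rewrite -[LHS]/0 -[RHS]/(b *: 0 + 0) scaler0 addr0.
- by move=> f g; rewrite -[LHS]/0 -[RHS]/(f * 0 + g * 0) !mulr0 addr0.
- move=> b f g; rewrite -[LHS]/(X (b *: f + g) - Y (b *: f + g)).
  rewrite -[RHS]/(b *: (X f - Y f) + (X g - Y g)) Xl Yl.
  by rewrite scalerBr opprD addrACA.
- move=> f g; rewrite -[LHS]/(X (f * g) - Y (f * g)).
  rewrite -[RHS]/(f * (X g - Y g) + g * (X f - Y f)) XM YM.
  by rewrite !mulrBr opprD addrACA.
Qed.

HB.instance Definition _ := GRing.isZmodClosed.Build
  (smoothFun M -> smoothFun M) derivation derivation_zmod_closed.

(* Smooth vector fields, as derivations of the ring of smooth functions. *)
Record vectorField := VectorField {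
  vf_val :> smoothFun M -> smoothFun M;
  vf_valP : vf_val \in derivation
}.

HB.instance Definition _ := [isSub for vf_val].
HB.instance Definition _ := [Choice of vectorField by <:].
HB.instance Definition _ := [SubChoice_isSubZmodule of vectorField by <:].

Lemma vfE (X : vectorField) : is_derivation X.
Proof. by apply/asboolP; exact: vf_valP. Qed.

Lemma smooth_scalerAr (a : R) (f g : smoothFun M) : a *: (f * g) = f * (a *: g).
Proof. by apply/val_inj/funext => x; exact: mulrCA. Qed.

Lemma vf_scale_subproof (f : smoothFun M) (X : vectorField) :
  (fun g => f * X g) \in derivation.
Proof.
have [Xl XM] := vfE X; apply/asboolP; split=> [a g h|g h].
  by rewrite Xl mulrDr smooth_scalerAr.
by rewrite XM mulrDr !(mulrCA f).
Qed.

Definition vf_scale f X := VectorField (vf_scale_subproof f X).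

Lemma vf_scaleA f g X : vf_scale f (vf_scale g X) = vf_scale (f * g) X.
Proof. by apply/val_inj/funext => h; rewrite /= mulrA. Qed.

Lemma vf_scale1 : left_id 1 vf_scale.
Proof. by move=> X; apply/val_inj/funext => h; rewrite /= mul1r. Qed.

Lemma vf_scaleDr : right_distributive vf_scale +%R.
Proof.
by move=> f X Y; apply/val_inj/funext => h; exact: mulrDr.
Qed.

Lemma vf_scaleDl X : {morph vf_scale^~ X : f g / f + g}.
Proof.
by move=> f g; apply/val_inj/funext => h; exact: mulrDl.
Qed.

HB.instance Definition _ := GRing.Zmodule_isLmodule.Build (smoothFun M)
  vectorField vf_scaleA vf_scale1 vf_scaleDr vf_scaleDl.

Lemma bracket_subproof (X Y : vectorField) :
  (fun f => X (Y f) - Y (X f)) \in derivation.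
Proof.
have [Xl XM] := vfE X; have [Yl YM] := vfE Y.
have XD f g : X (f + g) = X f + X g by rewrite -[f]scale1r Xl !scale1r.
have YD f g : Y (f + g) = Y f + Y g by rewrite -[f]scale1r Yl !scale1r.
apply/asboolP; split=> [a f g|f g].
  by rewrite Xl Yl Xl Yl scalerBr opprD addrACA.
rewrite XM YM XD YD !XM !YM !mulrBr.
set a := f * X (Y g); set b := Y g * X f; set c := g * X (Y f).
set d := Y f * X g; set a' := f * Y (X g); set c' := g * Y (X f).
rewrite (mulrC (X g)) (mulrC (X f)) -/b -/d.
rewrite (addrACA a b) (addrACA a' d) opprD (addrACA (a + c)) (addrC d b).
by rewrite subrr addr0 opprD addrACA.
Qed.

Definition bracket X Y := VectorField (bracket_subproof X Y).

Lemma vf_at_subproof (p : M) (X : vectorField) :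
  (fun f => X f p) \in point_derivation p.
Proof.
have [Xl XM] := vfE X; apply/asboolP; split=> [a f g|f g].
  by rewrite Xl.
by rewrite XM.
Qed.

Definition vf_at p X := Tangent (vf_at_subproof p X).

End vector_fields.

Section forms.
Context {R : realType} {n : nat}.
Variable M : smoothManifold R n.
Implicit Types X Y Z : vectorField M.

Record twoForm := TwoForm {
  form_at :> forall p : M, tangent p -> tangent p -> R;
  form_linear_l : forall p w, scalar ((form_at (p := p))^~ w);
  form_linear_r : forall p v, scalar (form_at (p := p) v);
  form_alternating : forall p (v : tangent p), form_at v v = 0;
  form_smooth : forall X Y,
    (fun p => form_at (vf_at p X) (vf_at p Y)) \in @smooth_pred R n M
}.

Definition form_eval (Omega : twoForm) X Y : smoothFun M :=
  SmoothFun (form_smooth Omega X Y).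

(* Invariant formula for dOmega(X, Y, Z). *)
Definition form_ext_deriv (Omega : twoForm) X Y Z : smoothFun M :=
  X (form_eval Omega Y Z) + Y (form_eval Omega Z X) + Z (form_eval Omega X Y)
  - form_eval Omega (bracket X Y) Z - form_eval Omega (bracket Y Z) X
  - form_eval Omega (bracket Z X) Y.

Definition form_lie_deriv (Omega : twoForm) Z X Y : smoothFun M :=
  Z (form_eval Omega X Y) - form_eval Omega (bracket Z X) Y
  - form_eval Omega X (bracket Z Y).

Definition form_nondegenerate (Omega : twoForm) : Prop :=
  forall (p : M) (v : tangent p), (forall w, Omega p v w = 0) -> v = 0.

Definition form_closed (Omega : twoForm) : Prop :=
  forall X Y Z, form_ext_deriv Omega X Y Z = 0.

Record symplecticForm := SymplecticForm {
  symplectic_form :> twoForm;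
  symplectic_nondegenerate : form_nondegenerate symplectic_form;
  symplectic_closed : form_closed symplectic_form
}.

Definition symplectic_vf (Omega : symplecticForm) Z : Prop :=
  forall X Y, form_lie_deriv Omega Z X Y = 0.

Record affineConnection := AffineConnection {
  nabla :> vectorField M -> vectorField M -> vectorField M;
  nabla_linear_l : forall Y, linear (nabla^~ Y);
  nabla_additive_r : forall X, {morph nabla X : Y Z / Y + Z};
  nabla_leibniz : forall X (f : smoothFun M) Y,
    nabla X (f *: Y) = X f *: Y + f *: nabla X Y
}.

Implicit Type D : affineConnection.

Definition torsion_free D : Prop :=
  forall X Y, D X Y - D Y X = bracket X Y.

(* (nabla_X Omega)(Y, Z): the direction of differentiation comes first. *)
Definition form_cov_deriv D (Omega : twoForm) X Y Z : smoothFun M :=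
  X (form_eval Omega Y Z) - form_eval Omega (D X Y) Z
  - form_eval Omega Y (D X Z).

Definition symplectic_connection D (Omega : symplecticForm) : Prop :=
  torsion_free D /\ forall X Y Z, form_cov_deriv D Omega X Y Z = 0.

Definition curvature D X Y Z : vectorField M :=
  D X (D Y Z) - D Y (D X Z) - D (bracket X Y) Z.

(* R(x, y)z for tangent vectors at [p]: since the curvature is tensorial and
   tangent vectors extend to vector fields, the set below is a singleton. *)
Definition curvature_at D (p : M) (x y z : tangent p) : tangent p :=
  xget 0 [set w | exists X Y Z, [/\ vf_at p X = x, vf_at p Y = y,
    vf_at p Z = z & w = vf_at p (curvature D X Y Z)]].

End forms.

Section sectional_curvature.
Context {R : realType} {n : nat} {M : smoothManifold R n}.
Variables (Omega : symplecticForm M) (D : affineConnection M) (p : M).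
Implicit Types (L : set (tangent p)) (x y z : tangent p).

Definition plane_basis L x y : Prop :=
  (forall a b : R, a *: x + b *: y = 0 -> a = 0 /\ b = 0) /\
  L = [set z | exists a b : R, z = a *: x + b *: y].

Definition is_plane L : Prop := exists x y, plane_basis L x y.

Definition symplectic_plane L : Prop :=
  is_plane L /\
  forall x, L x -> (forall y, L y -> Omega p x y = 0) -> x = 0.

(* The quadratic form K_{p,L}: for a symplectic plane [L] the set below is a
   singleton, the quotient being independent of the basis. *)
Definition sectional_form L z : R :=
  xget 0 [set k | exists x y, plane_basis L x y /\
    k = Omega p (curvature_at D x y z) z / Omega p x y].

Definition positive_definite_on L (q : tangent p -> R) : Prop :=
  forall z, L z -> z <> 0 -> 0 < q z.

Definition negative_definite_on L (q : tangent p -> R) : Prop :=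
  forall z, L z -> z <> 0 -> q z < 0.

Definition definite_on L (q : tangent p -> R) : Prop :=
  positive_definite_on L q \/ negative_definite_on L q.

End sectional_curvature.

(* Main.v *)
Require Import Defs.
From HB Require Import structures.
From mathcomp Require Import all_boot all_order all_algebra.
From mathcomp Require Import all_classical all_reals all_analysis.
From mathcomp Require Import ring.

(** Write [A X] for [nabla_X Z].  As [nabla] is torsion-free and preserves
    [Omega], a field [Z] is symplectic exactly when [A] is skew for [Omega]:
    [Omega(A X, Y) = - Omega(X, A Y)] ([symplectic_vf_skew]).  With [A Z = 0]
    this makes [A X] orthogonal to [Z] for every [X], and differentiating these
    vanishing functions gives
      [Omega(R(X, Y)Z, Z) = 2 Omega(A X, A Y)] ([curvature_symplectic_vf]).
    Suppose now that [Z_p = a X_p + b Y_p].  Skewness turns the right-hand side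
    into [- 2 Omega(X, A (A Y))], which at [p] depends on [X] only through
    [X_p]; hence [a Omega(A X, A Y)] equals [Omega(A Z, A Y) = 0] at [p], since
    [Omega(A Y, A Y) = 0].  In the same way [b Omega(A X, A Y) = 0] at [p].  As
    [Z_p] is nonzero, one of [a], [b] is, so the sectional form of any plane
    through [Z_p] vanishes at the nonzero vector [Z_p] and is not definite.

    The curvature at [p] is computed from arbitrary extensions of tangent
    vectors.  The formula above accepts any extensions of [X_p] and [Y_p] but
    needs the field [Z] itself in the last two slots.  The symmetry
    [Omega(R(X, Y)U, W) = Omega(R(X, Y)W, U)] ([curvature_sym]) allows another
    extension [Z'] of [Z_p] to be replaced by [Z]: it moves [Z'] into the slot
    where only its value at [p] matters.  Thus no bump functions or local frames
    are involved. *)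

Set Implicit Arguments.
Unset Strict Implicit.
Unset Printing Implicit Defensive.

Import Order.TTheory GRing.Theory Num.Theory numFieldNormedType.Exports.

Local Open Scope classical_set_scope.
Local Open Scope ring_scope.

Section vector_field_values.
Context {R : realType} {n : nat} {M : smoothManifold R n}.
Implicit Types (X Y W : vectorField M) (f g : smoothFun M) (Om : twoForm M).

Lemma vf_atB (p : M) X Y : vf_at p (X - Y) = vf_at p X - vf_at p Y.
Proof. by apply/val_inj/funext. Qed.

Lemma vfD X f g : X (f + g) = X f + X g.
Proof. by have [Xl _] := vfE X; rewrite -[f]scale1r Xl !scale1r. Qed.

Lemma vf0 X : X 0 = 0.
Proof. by apply: (addrI (X 0)); rewrite -vfD !addr0. Qed.

Section form_at_a_point.
Variables (Om : twoForm M) (p : M).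
Implicit Types u v w : tangent p.

Lemma form_combl (a b : R) u v w :
  Om p (a *: u + b *: v) w = a * Om p u w + b * Om p v w.
Proof.
have := form_linear_l Om w b v 0.
have := form_linear_l Om w a u (b *: v).
have := form_linear_l Om w 1 0 0.
rewrite scaler0 !addr0 mul1r => /(congr1 (fun r => r - Om p 0 w)).
by rewrite subrr addrK => <- /= -> ->; rewrite addr0.
Qed.

Lemma form0l w : Om p 0 w = 0.
Proof. by have := form_combl 0 0 0 0 w; rewrite !scale0r addr0 !mul0r addr0. Qed.

Lemma formBl u v w : Om p (u - v) w = Om p u w - Om p v w.
Proof.
by have := form_combl 1 (-1) u v w; rewrite scale1r scaleN1r mul1r mulN1r.
Qed.

Lemma formC u v : Om p u v = - Om p v u.
Proof.
have formDl (x y w : tangent p) : Om p (x + y) w = Om p x w + Om p y w.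
  by have := form_combl 1 1 x y w; rewrite !scale1r !mul1r.
have formDr (w x y : tangent p) : Om p w (x + y) = Om p w x + Om p w y.
  by have := form_linear_r Om w 1 x y; rewrite scale1r mul1r.
have := form_alternating Om (u + v).
rewrite formDl !formDr !form_alternating add0r addr0 => /eqP.
by rewrite addr_eq0 => /eqP.
Qed.

End form_at_a_point.

Lemma form_evalBl Om X Y W :
  form_eval Om (X - Y) W = form_eval Om X W - form_eval Om Y W.
Proof. by apply/val_inj/funext => p /=; rewrite vf_atB formBl. Qed.

Lemma form_evalC Om X Y : form_eval Om X Y = - form_eval Om Y X.
Proof. by apply/val_inj/funext => p /=; exact: formC. Qed.

Lemma form_evalxx Om X : form_eval Om X X = 0.
Proof. by apply/val_inj/funext => p /=; exact: form_alternating. Qed.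

Lemma form_eval0l Om X : form_eval Om 0 X = 0.
Proof. by rewrite -(subrr X) form_evalBl subrr. Qed.

Lemma form_eval0r Om X : form_eval Om X 0 = 0.
Proof. by rewrite form_evalC form_eval0l oppr0. Qed.

End vector_field_values.

Section symplectic_connections.
Context {R : realType} {n : nat} {M : smoothManifold R n}.
Context {Omega : symplecticForm M} {D : affineConnection M}.
Hypothesis D_symplectic : symplectic_connection D Omega.
Implicit Types X Y U W Z : vectorField M.

Local Notation "<| X , Y |>" := (form_eval Omega X Y)
  (at level 0, X, Y at level 99, format "<| X ,  Y |>").

Lemma vf_form_eval X Y W : X <|Y, W|> = <|D X Y, W|> + <|Y, D X W|>.
Proof.
have /eqP := D_symplectic.2 X Y W; rewrite /form_cov_deriv -addrA -opprD.
by rewrite subr_eq0 => /eqP.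
Qed.

(** The curvature endomorphism [R(X, Y)] is skew for [Omega], because
    [X Y - Y X - [X, Y]] kills the function [Omega(U, W)].  The antisymmetry of
    [Omega] turns this into a symmetry in [U] and [W]. *)
Lemma curvature_sym X Y U W :
  <|curvature D X Y U, W|> = <|curvature D X Y W, U|>.
Proof.
have := vf_form_eval (bracket X Y) U W.
rewrite -[LHS]/(X (Y <|U, W|>) - Y (X <|U, W|>)) !vf_form_eval !vfD.
rewrite !vf_form_eval /curvature !form_evalBl.
rewrite (form_evalC _ (D X (D Y W))) (form_evalC _ (D Y (D X W))).
rewrite (form_evalC _ (D (bracket X Y) W)).
move: <|D X (D Y U), W|> <|D Y (D X U), W|> <|D (bracket X Y) U, W|>.
move: <|U, D X (D Y W)|> <|U, D Y (D X W)|> <|U, D (bracket X Y) W|>.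
move: <|D X U, D Y W|> <|D Y U, D X W|> => s t a b c a' b' c' e.
have -> : c' = (a' + t + (s + a)) - (b' + s + (t + b)) - c.
  by rewrite e addrK.
ring.
Qed.

(** For a torsion-free connection preserving [Omega], the Lie derivative of
    [Omega] along [Z] is [Omega(nabla_X Z, Y) + Omega(X, nabla_Y Z)]. *)
Lemma symplectic_vf_skew Z X Y : symplectic_vf Omega Z ->
  <|D X Z, Y|> = - <|X, D Y Z|>.
Proof.
move=> /(_ X Y); rewrite /form_lie_deriv vf_form_eval -!D_symplectic.1.
rewrite form_evalBl (form_evalC _ X (_ - _)) form_evalBl.
rewrite (form_evalC _ (D Z Y)) (form_evalC _ (D Y Z)).
move: <|D X Z, Y|> <|X, D Y Z|> <|D Z X, Y|> <|X, D Z Y|> => s t a b e.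
by apply/eqP; rewrite -addr_eq0; apply/eqP; rewrite -e; ring.
Qed.

Section geodesic_symplectic_field.
Context {Z : vectorField M}.
Hypotheses (Z_symplectic : symplectic_vf Omega Z) (DZZ : D Z Z = 0).

Lemma nabla_symplectic_orth X : <|D X Z, Z|> = 0.
Proof. by rewrite symplectic_vf_skew// DZZ form_eval0r oppr0. Qed.

Lemma curvature_symplectic_vf X Y :
  <|curvature D X Y Z, Z|> = <|D X Z, D Y Z|> *+ 2.
Proof.
have second_deriv U W : <|D U (D W Z), Z|> = - <|D W Z, D U Z|>.
  have := vf_form_eval U (D W Z) Z; rewrite nabla_symplectic_orth vf0.
  by move/esym/eqP; rewrite addr_eq0 => /eqP.
rewrite /curvature !form_evalBl !second_deriv nabla_symplectic_orth subr0 opprK.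
by rewrite (form_evalC _ (D Y Z)) opprK mulr2n.
Qed.

(** The pairing moved to [Omega(X, nabla_(nabla_Y Z) Z)] sees [X] only through
    [X_p], so that [X_p] may be traded for [Z_p]. *)
Lemma nabla_pairing_eq0 (p : M) X Y (a b : R) :
  vf_at p Z <> 0 -> vf_at p Z = a *: vf_at p X + b *: vf_at p Y ->
  <|D X Z, D Y Z|> p = 0.
Proof.
move=> Zp0 Zp.
have skew U W : <|D U Z, D W Z|> p = - <|U, D (D W Z) Z|> p.
  by rewrite symplectic_vf_skew.
(* By skewness [a *: X_p + b *: Y_p = Z_p] transfers to the pairings, as
   [Omega(nabla_Z Z, _) = 0]; [W := Y] and [W := X] then kill one term each. *)
have comb W : a * <|D X Z, D W Z|> p + b * <|D Y Z, D W Z|> p = 0.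
  rewrite !skew !mulrN -opprD /= -form_combl -Zp.
  by have := skew Z W; rewrite DZZ form_eval0l /= => <-.
have aE : a * <|D X Z, D Y Z|> p = 0.
  by have := comb Y; rewrite form_evalxx mulr0 addr0.
have bE : b * <|D X Z, D Y Z|> p = 0.
  have := comb X; rewrite form_evalxx mulr0 add0r form_evalC /= mulrN.
  by move/eqP; rewrite oppr_eq0 => /eqP.
have [//|nz] := eqVneq (<|D X Z, D Y Z|> p) 0.
move/eqP: aE; rewrite mulf_eq0 (negPf nz) orbF => /eqP a0.
move/eqP: bE; rewrite mulf_eq0 (negPf nz) orbF => /eqP b0.
by case: Zp0; rewrite Zp a0 b0 !scale0r addr0.
Qed.

Lemma curvature_at_symplectic_vf (p : M) (x y : tangent p) (a b : R) :
  vf_at p Z <> 0 -> vf_at p Z = a *: x + b *: y ->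
  Omega p (curvature_at D x y (vf_at p Z)) (vf_at p Z) = 0.
Proof.
move=> Zp0 Zp; rewrite /curvature_at.
case: xgetP => [_ -> [X [Y [Z' [Xp Yp Z'p ->]]]]|_]; last exact: form0l.
rewrite -[LHS]/(<|curvature D X Y Z', Z|> p) curvature_sym /= Z'p.
rewrite -[LHS]/(<|curvature D X Y Z, Z|> p) curvature_symplectic_vf mulr2n.
rewrite -[LHS]/(<|D X Z, D Y Z|> p + <|D X Z, D Y Z|> p).
by rewrite (@nabla_pairing_eq0 _ _ _ a b) ?addr0// Xp Yp.
Qed.

Lemma sectional_form_symplectic_vf (p : M) (L : set (tangent p)) :
  vf_at p Z <> 0 -> L (vf_at p Z) ->
  sectional_form Omega D L (vf_at p Z) = 0.
Proof.
move=> Zp0 LZ; rewrite /sectional_form.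
case: xgetP => // _ -> [x [y [[_ LE] ->]]].
move: LZ; rewrite LE => -[a [b Zp]].
by rewrite (curvature_at_symplectic_vf Zp0 Zp) mul0r.
Qed.

End geodesic_symplectic_field.
End symplectic_connections.

Theorem corollary8p1 (R : realType) (n : nat) (M : smoothManifold R n)
    (Omega : symplecticForm M) (D : affineConnection M)
    (D_symplectic : symplectic_connection D Omega)
    (Z : vectorField M) (Z_symplectic : symplectic_vf Omega Z)
    (DZZ : D Z Z = 0)
    (p : M) (Zp_neq0 : vf_at p Z <> 0)
    (L : set (tangent p)) (L_symplectic : symplectic_plane Omega L)
    (Zp_in_L : L (vf_at p Z)) :
  ~ definite_on L (sectional_form Omega D L).
Proof.
have K0 :=
  sectional_form_symplectic_vf D_symplectic Z_symplectic DZZ Zp_neq0 Zp_in_L.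
by case=> /(_ _ Zp_in_L Zp_neq0); rewrite K0 ltxx.
Qed.
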